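(* Let $G$ be an infinite discrete group and let $\mathcal A$ be a Banach algebra such that there exists an algebra isomorphism $\rho:(\ell^1(\mathbb N),\bullet)\to\mathcal A$ onto its image such that $\rho(\ell^1(\mathbb N))$ is complemented in $\mathcal A$. Let $X=\ell^1(G,\mathcal A)$ and let $\{h_n\}_{n\in\mathbb N}$ be a countable set of distinct elements of $G$. Then for each non-principal ultrafilter $\mathcal U$ on $\mathbb N$, the formula $$\varphi_{\mathcal U}(\tau)=\lim_{\mathcal U}\tau(\delta_{h_n}\otimes\rho(e_n))\qquad\text{for all }\tau\in X^*$$ defines a functional $\varphi_{\mathcal U}\in X^{**}$ such that $\varphi_{\mathcal U}\notin J(X)$.
   Context: All Banach algebras are complex. $(\ell^1(\mathbb N),\bullet)$ is $\ell^1(\mathbb N)$ with pointwise multiplication, and $e_n$ denotes its $n$-th standard unit vector. The algebra isomorphism $\rho$ onto its image is understood to be a bounded linear map. A closed subspace $\mathcal B$ of a Banach space $\mathcal A$ is complemented in $\mathcal A$ if $\mathcal A=\mathcal B\oplus\mathcal C$ for some closed subspace $\mathcal C$ of $\mathcal A$, where $\|(b,c)\|=\|b\|+\|c\|$. For a discrete group $G$ and a Banach algebra $\mathcal A$, $\ell^1(G,\mathcal A)$ is the Banach algebra of all absolutely summable functions $f:G\to\mathcal A$ with norm $\|f\|_1=\sum_{g\in G}\|f(g)\|$ and convolution product $(f\ast g)(x)=\sum_{s\in G}f(s)g(s^{-1}x)$. For $h\in G$ and $a\in\mathcal A$, $\delta_h\otimes a\in\ell^1(G,\mathcal A)$ is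 the function taking the value $a$ at $h$ and $0$ elsewhere. $J:X\to X^{**}$ is the canonical embedding, and $\lim_{\mathcal U}$ denotes the limit of a bounded scalar sequence (indexed by $n$) along the ultrafilter $\mathcal U$. *)

(* Defs.v *)
From HB Require Import structures.
From mathcomp Require Import all_boot all_order all_algebra.
From mathcomp Require Import complex.
From mathcomp Require Import all_classical all_reals all_analysis.

Set Implicit Arguments.
Unset Strict Implicit.
Unset Printing Implicit Defensive.

Import Order.TTheory GRing.Theory Num.Theory.
Import numFieldNormedType.Exports.

Local Open Scope classical_set_scope.
Local Open Scope complex_scope.
Local Open Scope ring_scope.

(* No unit is required: (l^1(N), pointwise product) has none. *)
HB.mixin Record CompleteNormedModule_isBanachAlgebra (K : numFieldType) A
    & CompleteNormedModule K A := {
  bmul : A -> A -> A;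
  bmulA : associative bmul;
  bmulDl : left_distributive bmul +%R;
  bmulDr : right_distributive bmul +%R;
  bscalerAl : forall (a : K) (x y : A), a *: bmul x y = bmul (a *: x) y;
  bscalerAr : forall (a : K) (x y : A), a *: bmul x y = bmul x (a *: y);
  bnormM : forall x y : A, `|bmul x y| <= `|x| * `|y|
}.

#[short(type="banachAlgType")]
HB.structure Definition BanachAlgebra (K : numFieldType) :=
  {A of CompleteNormedModule K A & CompleteNormedModule_isBanachAlgebra K A}.

Definition bounded_linear (K : numFieldType) (V W : normedModType K)
    (f : V -> W) : Prop :=
  linear f /\ exists M : K, forall x, `|f x| <= M * `|x|.

Definition closed_subspace (K : numFieldType) (V : normedModType K)
    (B : set V) : Prop :=
  [/\ closed B, B 0 & forall (a : K) x y, B x -> B y -> B (a *: x + y)].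

(* The last two clauses say that (b, c) |-> b + c is an isomorphism of Banach
   spaces from B (+) C, normed by |b| + |c|, onto V; the converse estimate
   |b + c| <= |b| + |c| is the triangle inequality. *)
Definition complemented (K : numFieldType) (V : normedModType K)
    (B : set V) : Prop :=
  closed_subspace B /\
  exists C : set V,
    [/\ closed_subspace C,
        B `&` C = [set 0],
        forall x, exists b c, [/\ B b, C c & x = b + c] &
        exists M : K, forall b c, B b -> C c -> `|b| + `|c| <= M * `|b + c|].

Section real_norm.
Context {R : realType} {V : normedModType R[i]}.
Implicit Types x y : V.

(* Norms of a complex normed module are elements of R[i]; this is the same norm
   as a real number, see nrmE. *)
Definition nrm x : R := complex.Re `|x|.

Lemma nrmE x : `|x| = (nrm x)%:C.
Proof. by rewrite /nrm RRe_real. Qed.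

Lemma nrm_ge0 x : 0 <= nrm x.
Proof. by rewrite -ler0c -nrmE. Qed.

Lemma nrm0 : nrm 0 = 0.
Proof. by rewrite /nrm normr0. Qed.

Lemma nrm_eq0 x : nrm x = 0 -> x = 0.
Proof. by move=> x0; apply/normr0_eq0; rewrite nrmE x0. Qed.

Lemma ler_nrmD x y : nrm (x + y) <= nrm x + nrm y.
Proof. by rewrite -lecR rmorphD /= -!nrmE ler_normD. Qed.

End real_norm.

Lemma nrmZ (R : realType) (V : normedModType R[i]) (l : R[i]) (x : V) :
  nrm (l *: x) = nrm (l : R[i]^o) * nrm x.
Proof.
by apply/(@complexI R); rewrite rmorphM /= -!nrmE normrZ.
Qed.

Section l1.
Context {R : realType}.

Definition abs_summable (I : choiceType) (V : normedModType R[i]) (f : I -> V)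
    : Prop :=
  (\esum_(i in [set: I]) (nrm (f i))%:E < +oo)%E.

Section space.
Variables (I : choiceType) (V : normedModType R[i]).

Record l1 := L1 { l1_fun :> I -> V; _ : `[< abs_summable l1_fun >] }.

HB.instance Definition _ := [isSub for l1_fun].
HB.instance Definition _ := [Choice of l1 by <:].

Lemma abs_summable_l1 (f : l1) : abs_summable f.
Proof. by apply/asboolP; exact: valP f. Qed.

Definition mkl1 (f : I -> V) (sf : abs_summable f) : l1 := L1 (asboolT sf).

Let le_esumZ (l : R[i]) (f : I -> V) :
  (\esum_(i in [set: I]) (nrm (l *: f i))%:E <=
   (nrm (l : R[i]^o))%:E * \esum_(i in [set: I]) (nrm (f i))%:E)%E.
Proof.
apply: ge_ereal_sup => _ [A [finA _] <-].
rewrite (eq_fsbigr (fun i => (nrm (l : R[i]^o))%:E * (nrm (f i))%:E)%E); last first.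
  by move=> i _; rewrite -EFinM nrmZ.
rewrite -ge0_mule_fsumr; last by move=> i; rewrite lee_fin nrm_ge0.
apply: lee_wpmul2l; first by rewrite lee_fin nrm_ge0.
by apply: ereal_sup_ubound; exists A.
Qed.

Let le_esumD (f g : I -> V) :
  (\esum_(i in [set: I]) (nrm (f i + g i))%:E <=
   \esum_(i in [set: I]) (nrm (f i))%:E +
   \esum_(i in [set: I]) (nrm (g i))%:E)%E.
Proof.
rewrite -esumD; [|by move=> i _; rewrite lee_fin nrm_ge0..].
by apply: le_esum => i _; rewrite -EFinD lee_fin ler_nrmD.
Qed.

Fact l1_submod_closed :
  submod_closed [pred f : I -> V | `[< abs_summable f >]].
Proof.
split=> [|a f g]; rewrite -!topredE /=.
  apply/asboolP; rewrite /abs_summable esum1 ?ltry// => i _.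
  by rewrite nrm0.
move=> /asboolP sf /asboolP sg; apply/asboolP.
apply: (le_lt_trans (le_esumD _ _)); apply: lte_add_pinfty => //.
apply: (le_lt_trans (le_esumZ _ _)); apply: lte_mul_pinfty => //.
by rewrite lee_fin nrm_ge0.
Qed.

HB.instance Definition _ :=
  GRing.SubChoice_isSubLmodule.Build _ _ _ l1 l1_submod_closed.

Definition l1_norm (f : l1) : R :=
  fine (\esum_(i in [set: I]) (nrm (f i))%:E).

Lemma l1_normE (f : l1) :
  (l1_norm f)%:E = (\esum_(i in [set: I]) (nrm (f i))%:E)%E.
Proof.
rewrite fineK// ge0_fin_numE; first exact: abs_summable_l1.
by apply: esum_ge0 => i _; rewrite lee_fin nrm_ge0.
Qed.

Let l1_normC (f : l1) : R[i] := (l1_norm f)%:C.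

Let l1_normD (f g : l1) : l1_normC (f + g) <= l1_normC f + l1_normC g.
Proof.
by rewrite -rmorphD /= lecR -lee_fin EFinD !l1_normE le_esumD.
Qed.

Let le_l1_normZ (l : R[i]) (f : l1) : l1_normC (l *: f) <= `|l| * l1_normC f.
Proof.
rewrite (nrmE (l : R[i]^o)) -rmorphM /= lecR -lee_fin EFinM !l1_normE.
exact: le_esumZ.
Qed.

Lemma nrm_le_l1_norm (f : l1) (i : I) : nrm (f i) <= l1_norm f.
Proof.
rewrite -lee_fin l1_normE; apply: esum_ge; exists [set i]; first by split.
by rewrite fsbig_set1.
Qed.

Let l1_norm_eq0 (f : l1) : l1_normC f = 0 -> f = 0.
Proof.
move=> /(@complexI R) f0; apply/val_inj/funext => i /=.
by apply: nrm_eq0; apply/eqP; rewrite eq_le nrm_ge0 andbT -f0 nrm_le_l1_norm.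
Qed.

Let l1_normZ (l : R[i]) (f : l1) : l1_normC (l *: f) = `|l| * l1_normC f.
Proof.
apply/eqP; rewrite eq_le le_l1_normZ /=.
have [->|l0] := eqVneq l 0.
  rewrite normr0 mul0r lecR -lee_fin l1_normE.
  by apply: esum_ge0 => i _; rewrite lee_fin nrm_ge0.
rewrite -ler_pdivlMl ?normr_gt0// -normfV.
by rewrite -{1}[f](scalerK l0) le_l1_normZ.
Qed.

HB.instance Definition _ :=
  Lmodule_isNormed.Build R[i] l1 l1_normD l1_normZ l1_norm_eq0.

Lemma l1_normrE (f : l1) : `|f| = (l1_norm f)%:C.
Proof. by []. Qed.

Fact abs_summable_delta (h : I) (a : V) :
  abs_summable (fun i => if i == h then a else 0).
Proof.
rewrite /abs_summable (esumID [set h]); last first.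
  by move=> i _; rewrite lee_fin nrm_ge0.
rewrite setTI esum_set1 ?eqxx ?lee_fin ?nrm_ge0// esum1 ?adde0 ?ltry//.
by move=> i [_ /eqP/negPf ->]; rewrite nrm0.
Qed.

Definition l1_delta (h : I) (a : V) : l1 := mkl1 (abs_summable_delta h a).

End space.

Fact abs_summable_mul (I : choiceType) (f g : l1 I R[i]^o) :
  abs_summable (fun i => f i * g i : R[i]^o).
Proof.
have sfg := abs_summable_l1 ((l1_norm f)%:C *: g).
apply: le_lt_trans sfg; apply: le_esum => i _.
rewrite lee_fin -lecR -!nrmE /= normrZ normrM ler_wpM2r//.
rewrite (nrmE (f i)) ger0_norm ?ler0c ?lecR ?nrm_le_l1_norm//.
by rewrite (le_trans (nrm_ge0 (f i)))// nrm_le_l1_norm.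
Qed.

Definition l1_mul (I : choiceType) (f g : l1 I R[i]^o) : l1 I R[i]^o :=
  mkl1 (abs_summable_mul f g).

End l1.

Section dual.
Context {R : realType}.

Section space.
Variable V : normedModType R[i].

Record dual_space := DualSpace {
  dual_fun :> V -> R[i]^o;
  _ : `[< bounded_linear dual_fun >]
}.

HB.instance Definition _ := [isSub for dual_fun].
HB.instance Definition _ := [Choice of dual_space by <:].

Lemma dual_bounded_linear (f : dual_space) : bounded_linear f.
Proof. by apply/asboolP; exact: valP f. Qed.

Definition mkdual (f : V -> R[i]^o) (bf : bounded_linear f) : dual_space :=
  DualSpace (asboolT bf).

Fact dual_submod_closed :
  submod_closed [pred f : V -> R[i]^o | `[< bounded_linear f >]].
Proof.
split=> [|a f g]; rewrite -!topredE /=.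
  apply/asboolP; split=> [b x y|]; first by rewrite /= scaler0 addr0.
  by exists 0 => x; rewrite normr0 mul0r.
move=> /asboolP[lf [M fM]] /asboolP[lg [N gN]]; apply/asboolP; split.
  move=> b x y /=; rewrite !fctE lf lg !scalerDr !scalerA (mulrC a b).
  by rewrite addrACA.
exists (`|a| * M + N) => x /=; rewrite !fctE mulrDl -mulrA.
by rewrite (le_trans (ler_normD _ _))// normrZ lerD// ler_wpM2l.
Qed.

HB.instance Definition _ :=
  GRing.SubChoice_isSubLmodule.Build _ _ _ dual_space dual_submod_closed.

Definition dual_norm (f : dual_space) : R :=
  sup [set nrm (f x) | x in [set x : V | `|x| <= 1]].

Let nrm_has_ubound (f : dual_space) :
  has_ubound [set nrm (f x) | x in [set x : V | `|x| <= 1]].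
Proof.
have [_ [M fM]] := dual_bounded_linear f.
exists (nrm (M : R[i]^o)) => _ [x /= x1 <-]; rewrite -lecR -!nrmE.
have Mx0 : 0 <= M * `|x| by rewrite (le_trans _ (fM x)).
rewrite (le_trans (fM x))// -(ger0_norm Mx0) normrM normr_id.
by rewrite ler_piMr.
Qed.

Lemma dual_norm_ub (f : dual_space) (x : V) : `|x| <= 1 -> nrm (f x) <= dual_norm f.
Proof. by move=> x1; apply: ub_le_sup => //; exists x. Qed.

Lemma dual_norm_le (f : dual_space) (M : R) :
  (forall x : V, `|x| <= 1 -> nrm (f x) <= M) -> dual_norm f <= M.
Proof.
move=> fM; apply: ge_sup; last by move=> _ [x x1 <-]; exact: fM.
by exists (nrm (f 0)); exists 0 => //=; rewrite normr0 ler01.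
Qed.

Let dual_norm_ge0 (f : dual_space) : 0 <= dual_norm f.
Proof.
by rewrite (le_trans (nrm_ge0 (f 0)))// dual_norm_ub// normr0 ler01.
Qed.

Let dual_normC (f : dual_space) : R[i] := (dual_norm f)%:C.

Let dual_normD (f g : dual_space) :
  dual_normC (f + g) <= dual_normC f + dual_normC g.
Proof.
rewrite -rmorphD /= lecR; apply: dual_norm_le => x x1.
by rewrite (le_trans (ler_nrmD _ _))// lerD// dual_norm_ub.
Qed.

Let le_dual_normZ (l : R[i]) (f : dual_space) :
  dual_normC (l *: f) <= `|l| * dual_normC f.
Proof.
rewrite (nrmE (l : R[i]^o)) -rmorphM /= lecR; apply: dual_norm_le => x x1.
by rewrite (nrmZ l (f x)) ler_wpM2l ?nrm_ge0 ?dual_norm_ub.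
Qed.

Let dual_normZ (l : R[i]) (f : dual_space) :
  dual_normC (l *: f) = `|l| * dual_normC f.
Proof.
apply/eqP; rewrite eq_le le_dual_normZ /=.
have [->|l0] := eqVneq l 0; first by rewrite normr0 mul0r ler0c.
rewrite -ler_pdivlMl ?normr_gt0// -normfV.
by rewrite -{1}[f](scalerK l0) le_dual_normZ.
Qed.

Lemma dual_norm_bound (f : dual_space) (x : V) : nrm (f x) <= dual_norm f * nrm x.
Proof.
have [lf _] := dual_bounded_linear f.
have f0 : f 0 = 0 by have := lf (-1) 0 0; rewrite scaler0 addr0 scaleN1r addNr.
have [->|x0] := eqVneq x 0; first by rewrite f0 !nrm0 mulr0.
have nx0 : `|x| != 0 by rewrite normr_eq0.
have fE : f x = `|x| *: f (`|x|^-1 *: x).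
  have := lf (`|x|) (`|x|^-1 *: x) 0.
  by rewrite f0 !addr0 scalerA mulfV// scale1r.
rewrite fE nrmZ mulrC; apply: ler_pM; rewrite ?nrm_ge0//.
  by rewrite dual_norm_ub// normfZV.
by rewrite /nrm normr_id.
Qed.

Let dual_norm_eq0 (f : dual_space) : dual_normC f = 0 -> f = 0.
Proof.
move=> /(@complexI R) f0; apply/val_inj/funext => x /=; apply: nrm_eq0.
apply/eqP; rewrite eq_le nrm_ge0 andbT.
by rewrite (le_trans (dual_norm_bound f x))// f0 mul0r.
Qed.

HB.instance Definition _ :=
  Lmodule_isNormed.Build R[i] dual_space dual_normD dual_normZ dual_norm_eq0.

Lemma dual_normrE (f : dual_space) : `|f| = (dual_norm f)%:C.
Proof. by []. Qed.

Lemma dual_normr_le (f : dual_space) (x : V) : `|f x| <= `|f| * `|x|.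
Proof. by rewrite dual_normrE !nrmE -rmorphM /= lecR dual_norm_bound. Qed.

End space.

Fact bidual_embed_bounded_linear (V : normedModType R[i]) (x : V) :
  bounded_linear (fun tau : dual_space V => tau x).
Proof.
split=> [a f g //|]; exists `|x| => f.
by rewrite mulrC dual_normr_le.
Qed.

Definition bidual_embed (V : normedModType R[i]) (x : V) :
    dual_space (dual_space V) :=
  mkdual (bidual_embed_bounded_linear x).

End dual.

(* Main.v *)
Require Import Defs.
From HB Require Import structures.
From mathcomp Require Import all_boot all_order all_algebra.
From mathcomp Require Import complex.
From mathcomp Require Import all_classical all_reals all_analysis.

Set Implicit Arguments.
Unset Strict Implicit.
Unset Printing Implicit Defensive.

Import Order.TTheory GRing.Theory Num.Theory.
Import numFieldNormedType.Exports.

Local Open Scope classical_set_scope.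
Local Open Scope complex_scope.
Local Open Scope ring_scope.

(** Let e_n be the unit vectors of l^1(N), and let x_n be the function on G
with value rho e_n at h_n and 0 elsewhere.

Existence. The evaluations tau |-> tau x_n are uniformly bounded functionals
on X^*, since |x_n| = |rho e_n| is bounded.  Bounded families of complex
numbers converge along an ultrafilter, and the pointwise limit of a uniformly
bounded family of functionals is again a bounded functional
([ultra_functional_lim]).

Not in J(X).  A bounded left inverse of rho would follow from the open mapping
theorem, but only the coordinates of this inverse are needed, and
multiplicativity gives them for free: rho g * rho e_n = g_n rho e_n forces
|g_n| <= |rho g| ([coordinate_le_mul_morphism]).  Composing with the projection
onto the complemented range of rho yields functionals lam_n on A, uniformly
bounded by some M, with lam_n (rho e_n) = 1.  For each N put
  tau_N F = sum_(n >= N) lam_n (F h_n),   F in X.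
This is bounded, tau_N x_n = 1 for n >= N, and |tau_N F| is at most M times the
tail sum_(n >= N) |F h_n| ([tail_functional]).  A non-principal ultrafilter
contains all tails of N, so phi tau_N = 1 for every N, whereas tau_N F tends
to 0 for each F in X.  Hence phi is not evaluation at any F.

The series defining tau_N is taken as the limit of its partial sums along U,
so that boundedness and linearity come from [ultra_functional_lim] again. *)

(** * Limits along an ultrafilter *)

(** A cluster point in [K] is a limit: an ultrafilter that missed the preimage
of one of its neighbourhoods would contain the complement. *)
Lemma ultra_compact_cvg (I : Type) (U : set_system I) (T : topologicalType)
    (K : set T) (u : I -> T) :
  UltraFilter U -> compact K -> (forall i, K (u i)) -> exists l : T, u @ U --> l.
Proof.
move=> UU cK Ku; have PU : ProperFilter U by exact: ultra_proper.
have [|l [_ lcl]] := cK (u @ U) _.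
  exact: (@filterE _ U _ (u @^-1` K) Ku).
exists l => B Bl; have [//|UBC] := in_ultra_setVsetC (u @^-1` B) UU.
have [x [/= nBx Bx]] := lcl (~` B) B UBC Bl.
by case: (nBx Bx).
Qed.

Lemma nrm_Re_le (R : realType) (z : R[i]^o) : `|complex.Re z| <= nrm z.
Proof. by rewrite -lecR -nrmE normc_ge_Re. Qed.

Lemma nrm_Im_le (R : realType) (z : R[i]^o) : `|complex.Im z| <= nrm z.
Proof.
rewrite -lecR -nrmE; have := normc_ge_Re (z * 'i%C).
by rewrite ReiNIm normrN normrM [X in _ * X]normc_def/= expr0n expr1n add0r
  sqrtr1 mulr1.
Qed.

Lemma nrm_le_ReIm (R : realType) (z : R[i]^o) :
  nrm z <= `|complex.Re z| + `|complex.Im z|.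
Proof.
rewrite -lecR -nrmE {1}[z]complexE (le_trans (ler_normD _ _))//.
rewrite rmorphD/= lerD//; first by rewrite normc_def/= expr0n addr0 sqrtr_sqr.
by rewrite normrM !normc_def/= !expr0n expr1n add0r addr0 sqrtr1 mul1r sqrtr_sqr.
Qed.

(** The topology of a complex normed module is given by radii in [R[i]]; this
allows real radii. *)
Lemma cvg_nrmP (R : realType) (V : normedModType R[i]) (I : Type)
    (F : set_system I) (u : I -> V) (l : V) : Filter F ->
  u @ F --> l <-> forall e : R, 0 < e -> \forall i \near F, nrm (l - u i) < e.
Proof.
move=> FF; rewrite cvgrPdist_lt; split=> ul e e0.
  have := ul e%:C; rewrite -[0]/(0%:C) ltcR => /(_ e0).
  by apply: filterS => i; rewrite nrmE ltcR.
have eE : (complex.Re e)%:C = e by rewrite RRe_real// gtr0_real.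
have := ul (complex.Re e); rewrite -ltcR eE => /(_ e0).
by apply: filterS => i; rewrite nrmE -{2}eE ltcR.
Qed.

(** Compactness of real segments, applied to the real and imaginary parts. *)
Lemma ultra_bounded_cvg (R : realType) (I : Type) (U : set_system I)
    (u : I -> R[i]^o) (M : R) :
  UltraFilter U -> (forall i, nrm (u i) <= M) -> exists l : R[i]^o, u @ U --> l.
Proof.
move=> UU uM; have PU : ProperFilter U by exact: ultra_proper.
have cvgM (v : I -> R) : (forall i, `|v i| <= M) -> exists l : R, v @ U --> l.
  move=> vM; apply: (@ultra_compact_cvg _ _ _ `[- M, M] v) => // [|i].
    exact: segment_compact.
  by rewrite /= in_itv/= -ler_norml.
have [i|x ux] := cvgM (fun i => complex.Re (u i)).
  exact: le_trans (nrm_Re_le _) (uM i).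
have [i|y uy] := cvgM (fun i => complex.Im (u i)).
  exact: le_trans (nrm_Im_le _) (uM i).
exists (x +i* y); apply/cvg_nrmP => e e0.
have e2 : 0 < e / 2 by rewrite divr_gt0.
move/cvgrPdist_lt : ux => /(_ _ e2); move/cvgrPdist_lt : uy => /(_ _ e2).
apply: filterS2 => i yi xi; apply: (le_lt_trans (nrm_le_ReIm _)).
by rewrite (splitr e); move: xi yi; case: (u i) => a b /=; exact: ltrD.
Qed.

Lemma nrm_lim_le (R : realType) (V : normedModType R[i]) (I : Type)
    (F : set_system I) (u : I -> V) (l : V) (M : R) : ProperFilter F ->
  u @ F --> l -> (forall i, nrm (u i) <= M) -> nrm l <= M.
Proof.
move=> PF /cvg_nrmP ul uM; apply/ler_addgt0Pl => e /ul/filter_ex[i li].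
by rewrite -[l](subrK (u i)) (le_trans (ler_nrmD _ _))// lerD// ltW//.
Qed.

(** The elementary form of weak-star compactness of balls of the dual: both the
functional on [X^*] of the theorem and the test functionals that separate it
from [X] are obtained as such limits. *)
Lemma ultra_functional_lim (R : realType) (V : normedModType R[i]) (I : Type)
    (U : set_system I) (T : I -> V -> R[i]^o) (M : R) :
  UltraFilter U -> (forall i, linear (T i)) ->
  (forall i x, nrm (T i x) <= M * nrm x) ->
  exists tau : dual_space V, forall x, T ^~ x @ U --> tau x.
Proof.
move=> UU Tlin TM; have PU : ProperFilter U by exact: ultra_proper.
have /choice[f Tf] x : exists l : R[i]^o, T ^~ x @ U --> l.
  exact: ultra_bounded_cvg UU (TM^~ x).
suff bf : bounded_linear f by exists (mkdual bf).
split=> [a x y|].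
  have cZ : (fun i => a *: T i x) @ U --> a *: f x.
    exact: (@cvgZl_tmp R[i] R[i]^o I U _ a (T^~ x) (f x) (Tf x)).
  have cD : (fun i => a *: T i x + T i y) @ U --> a *: f x + f y.
    exact: (@cvgD R[i] R[i]^o I U _ _ _ _ _ cZ (Tf y)).
  have fxy := Tf (a *: x + y).
  rewrite (_ : T^~ _ = (fun i => a *: T i x + T i y)) in fxy; last first.
    by apply/funext => i; rewrite Tlin.
  exact: (@norm_cvg_unique R[i] R[i]^o _ _ _ _ fxy cD).
exists M%:C => x; rewrite !nrmE -rmorphM lecR.
by apply: (@nrm_lim_le _ _ _ U (T^~ x)) => //; exact: Tf.
Qed.

(** An ultrafilter that contains a singleton contains, hence equals, the
corresponding principal ultrafilter, by maximality of the latter. *)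
Lemma nonprincipal_tail (U : set_system nat) :
  UltraFilter U -> (forall n, U <> principal_filter n) ->
  forall N, \forall n \near U, (N <= n)%N.
Proof.
move=> UU Unp; have PU : ProperFilter U by exact: ultra_proper.
have UC n : U (~` [set n]).
  have [Un|//] := in_ultra_setVsetC [set n] UU.
  case: (Unp n).
  apply: (@max_filter _ _ (principal_filter_ultra n) _ PU) => A.
  by move=> /principal_filterP An; apply: filterS Un => _ ->.
elim=> [|N IH]; first exact: filterE.
apply: filterS2 IH (UC N) => n Nn /= /eqP nN.
by rewrite ltn_neqAle eq_sym nN.
Qed.

(** * Left inverses on complemented ranges *)

(** The constant in [bounded_linear] is a complex number; its modulus serves as
a real one. *)
Lemma bounded_linear_nrm (R : realType) (V W : normedModType R[i])
    (f : V -> W) :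
  bounded_linear f -> exists M : R, forall x, nrm (f x) <= M * nrm x.
Proof.
move=> [_ [M fM]]; exists (nrm (M : R[i]^o)) => x.
rewrite -lecR rmorphM/= -!nrmE -[X in _ * X]normr_id -normrM.
by rewrite (le_trans (fM x))// real_ler_norm// ger0_real// (le_trans _ (fM x)).
Qed.

Lemma linear0 (K : numFieldType) (V W : lmodType K) (f : V -> W) :
  linear f -> f 0 = 0.
Proof.
by move=> lf; have := lf (-1) 0 0; rewrite scaler0 addr0 scaleN1r addNr.
Qed.

(** [P] projects onto the range of [f] along the complement and then inverts
[f].  The bound is on [f \o P], the projection itself: bounding [P] would take
the open mapping theorem. *)
Lemma complemented_left_inverse (R : realType) (V W : normedModType R[i])
    (f : V -> W) :
  linear f -> injective f -> complemented (range f) ->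
  exists P : W -> V, [/\ linear P, cancel f P &
    exists2 M : R, 0 <= M & forall x, nrm (f (P x)) <= M * nrm x].
Proof.
move=> lf injf [_ [C [[_ C0 Clin] BC0 dec [M CM]]]].
have /choice[P PC] x : exists v, C (x - f v).
  by have [_ [c [[v _ <-] Cc ->]]] := dec x; exists v; rewrite addrC addKr.
have uniqP x v : C (x - f v) -> P x = v.
  move=> Cv; apply/injf/eqP; rewrite -subr_eq0; apply/eqP.
  suff : (range f `&` C) (f (P x) - f v) by rewrite BC0.
  split; first by exists (-1 *: v + P x) => //; rewrite lf scaleN1r addrC.
  rewrite (_ : _ - _ = -1 *: (x - f (P x)) + (x - f v)); first exact: Clin.
  by rewrite scaleN1r opprB addrA subrK.
exists P; split=> [a x y|v|].
- by apply: uniqP; rewrite lf opprD addrACA -scalerBr; exact: Clin.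
- by apply: uniqP; rewrite subrr.
- exists (nrm (M : R[i]^o)) => [|x]; first exact: nrm_ge0.
  have fPx : `|f (P x)| + `|x - f (P x)| <= M * `|x|.
    have := CM (f (P x)) (x - f (P x)); rewrite [f (P x) + _]addrC subrK.
    by apply=> //; exists (P x).
  rewrite -lecR rmorphM/= -!nrmE -[X in _ * X]normr_id -normrM.
  rewrite (le_trans (y := M * `|x|))//; first by rewrite (le_trans _ fPx)// lerDl.
  by rewrite real_ler_norm// ger0_real// (le_trans _ fPx)// addr_ge0.
Qed.

(** Since [g * e_n = g n *: e_n] in [l1], submultiplicativity of the norm of
[A] gives [|g n| * |rho e_n| <= |rho g| * |rho e_n|], and [rho e_n] is nonzero
by injectivity. *)
Lemma coordinate_le_mul_morphism (R : realType) (A : banachAlgType R[i])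
    (rho : l1 nat R[i]^o -> A) :
  linear rho -> injective rho ->
  (forall f g : l1 nat R[i]^o, rho (l1_mul f g) = bmul (rho f) (rho g)) ->
  forall (g : l1 nat R[i]^o) n, nrm (g n) <= nrm (rho g).
Proof.
move=> lrho injrho Mrho g n; pose d : l1 nat R[i]^o := l1_delta n (1 : R[i]^o).
have rho0 : rho 0 = 0 by exact: linear0.
have gd : l1_mul g d = g n *: d.
  apply/val_inj/funext => k.
  change (g k * (if k == n then 1 else 0) = g n * (if k == n then 1 else 0)).
  by case: eqP => [->|_]; rewrite ?mulr1 ?mulr0.
have rd0 : 0 < `|rho d|.
  rewrite normr_gt0 -rho0 (inj_eq injrho).
  apply/eqP => /(congr1 (fun f : l1 nat R[i]^o => f n)).
  by rewrite /= eqxx => /eqP; rewrite oner_eq0.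
have := bnormM (rho g) (rho d).
rewrite -Mrho gd -[g n *: d]addr0 lrho rho0 addr0 normrZ ler_pM2r//.
by rewrite -lecR -!nrmE.
Qed.

(** * Functionals on l^1 supported on a tail *)

Lemma sum_nrm_le_l1_norm (R : realType) (I : choiceType) (V : normedModType R[i])
    (h : nat -> I) (F : l1 I V) (n : nat) :
  injective h -> \sum_(0 <= k < n) nrm (F (h k)) <= l1_norm F.
Proof.
move=> injh; rewrite -lee_fin l1_normE; apply: esum_ge.
exists (h @` `I_n); first by split=> //; apply: finite_image; exact: finite_II.
rewrite fsbig_image; last by move=> ? ? _ _; exact: injh.
by rewrite -fsbig_ord sumEFin big_mkord.
Qed.

Lemma bounded_sum_small_tail (R : realType) (a : nat -> R) (B e : R) :
  (forall n, \sum_(0 <= k < n) a k <= B) -> 0 < e ->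
  exists N, forall n, \sum_(N <= k < n) a k <= e.
Proof.
move=> aB e0; set S := range (fun n => \sum_(0 <= k < n) a k).
have ubS : ubound S B by move=> _ [n _ <-].
have supS : has_sup S.
  by split; [exists (\sum_(0 <= k < 0) a k); exists 0%N|exists B].
have [_ [N _ <-] supN] := sup_adherent e0 supS.
(* The sum up to N is within e of the supremum of all partial sums. *)
exists N => n; have [nN|Nn] := leqP n N; first by rewrite big_geq// ltW.
rewrite -(lerD2l (\sum_(0 <= k < N) a k)) -big_cat_nat//=; last exact: ltnW.
rewrite (le_trans (y := sup S)) ?ub_le_sup//; first exact: supS.2.
  by exists n.
by rewrite -lerBlDr ltW.
Qed.

Lemma l1_norm_delta (R : realType) (I : choiceType) (V : normedModType R[i])
    (i : I) (a : V) : l1_norm (l1_delta i a) = nrm a.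
Proof.
apply: EFin_inj; rewrite l1_normE (esumID [set i]); last first.
  by move=> j _; rewrite lee_fin nrm_ge0.
rewrite setTI esum_set1 ?lee_fin ?nrm_ge0//= eqxx esum1 ?adde0// => j [_ /=].
by move=> /eqP/negPf ->; rewrite nrm0.
Qed.

Lemma nrm_l1E (R : realType) (I : choiceType) (V : normedModType R[i])
    (F : l1 I V) : nrm F = l1_norm F.
Proof. by []. Qed.

(** [tau] is [F |-> \sum_(k >= N) lam k (F (h k))], with the sum taken along [U].
On a delta function the partial sums are eventually constant. *)
Lemma tail_functional (R : realType) (I : choiceType) (V : normedModType R[i])
    (h : nat -> I) (lam : nat -> V -> R[i]^o) (M : R) (U : set_system nat) :
  injective h -> UltraFilter U -> (forall N, \forall n \near U, (N <= n)%N) ->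
  0 <= M -> (forall k, linear (lam k)) ->
  (forall k x, nrm (lam k x) <= M * nrm x) ->
  forall N, exists tau : dual_space (l1 I V),
    (forall k x, (N <= k)%N -> tau (l1_delta (h k) x) = lam k x) /\
    forall (F : l1 I V) e,
      (forall n, \sum_(N <= k < n) nrm (F (h k)) <= e) ->
      nrm (tau F) <= M * e.
Proof.
move=> injh UU Utail M0 lin_lam lamM N.
have PU : ProperFilter U by exact: ultra_proper.
pose T n (F : l1 I V) : R[i]^o := \sum_(N <= k < n) lam k (F (h k)).
have nrmT n (F : l1 I V) : nrm (T n F) <= M * \sum_(N <= k < n) nrm (F (h k)).
  rewrite mulr_sumr /T; elim/big_ind2 : _ => [|x a y b xa yb|k _//].
    by rewrite nrm0.
  by rewrite (le_trans (ler_nrmD _ _))// lerD.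
have linT n : linear (T n).
  move=> a F G; rewrite /T scaler_sumr -big_split/=.
  by apply: eq_bigr => k _; exact: lin_lam.
have TM n F : nrm (T n F) <= M * nrm F.
  rewrite (le_trans (nrmT n F))// ler_wpM2l// nrm_l1E.
  rewrite (le_trans _ (sum_nrm_le_l1_norm F n injh))//.
  have [nN|Nn] := leqP n N.
    by rewrite big_geq// sumr_ge0// => k _; exact: nrm_ge0.
  rewrite [leRHS](big_cat_nat (n := N))//=; last exact: ltnW.
  by rewrite lerDr sumr_ge0// => k _; exact: nrm_ge0.
have [tau Ttau] := ultra_functional_lim UU linT TM.
exists tau; split=> [k x Nk|F e Fe].
  have Tk : (fun=> lam k x) @ U --> tau (l1_delta (h k) x).
    apply: cvg_trans (Ttau (l1_delta (h k) x)); apply: near_eq_cvg.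
    apply: filterS (Utail k.+1) => n kn; rewrite /T.
    rewrite (bigD1_seq k) ?mem_index_iota ?Nk ?iota_uniq//= eqxx.
    rewrite big1 ?addr0// => j jk.
    by rewrite (inj_eq injh) (negPf jk) linear0.
  exact: (@norm_cvg_unique R[i] R[i]^o _ _ _ _ Tk (cvg_cst _)).
apply: (@nrm_lim_le _ R[i]^o _ U (T^~ F) _ _ _ (Ttau F)) => n.
by rewrite (le_trans (nrmT n F))// ler_wpM2l.
Qed.

(** * The functional defined by the ultrafilter *)

Lemma nrm1 (R : realType) : nrm (1 : R[i]^o) = 1 :> R.
Proof. by rewrite /nrm normr1. Qed.

Theorem proposition3p2 (R : realType) (G : groupType) (A : banachAlgType R[i])
    (rho : l1 nat R[i]^o -> A) (h : nat -> G) :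
  infinite_set [set: G] ->
  bounded_linear rho ->
  (forall f g : l1 nat R[i]^o, rho (l1_mul f g) = bmul (rho f) (rho g)) ->
  injective rho ->
  complemented (range rho) ->
  injective h ->
  forall U : set_system nat,
    UltraFilter U ->
    (forall n : nat, U <> principal_filter n) ->
    exists phi : dual_space (dual_space (l1 G A)),
      (forall tau : dual_space (l1 G A),
         (fun n => tau (l1_delta (h n) (rho (l1_delta n (1 : R[i]^o)))))
           @ U --> phi tau) /\
      ~ range (@bidual_embed R (l1 G A)) phi.
Proof.
move=> _ brho Mrho injrho crho injh U UU Unp.
have PU : ProperFilter U by exact: ultra_proper.
have Utail := nonprincipal_tail UU Unp.
have [lrho _] := brho.
have [rhoM rho_le] := bounded_linear_nrm brho.
have [P [linP rhoK [M M0 PM]]] := complemented_left_inverse lrho injrho crho.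
pose x n := l1_delta (h n) (rho (l1_delta n (1 : R[i]^o))).
have [||phi phiE] := @ultra_functional_lim R (dual_space (l1 G A)) nat U
    (fun n tau => tau (x n)) rhoM UU.
- by move=> n a f g.
- move=> n tau; rewrite mulrC (le_trans (dual_norm_bound tau (x n)))//.
  apply: ler_wpM2l; first exact: (nrm_ge0 tau).
  rewrite nrm_l1E l1_norm_delta.
  by rewrite (le_trans (rho_le _))// nrm_l1E l1_norm_delta nrm1 mulr1.
exists phi; split=> // -[F _ phiF].
pose lam n (a : A) : R[i]^o := P a n.
have lin_lam n : linear (lam n) by move=> a b c; rewrite /lam linP.
have lamM n a : nrm (lam n a) <= M * nrm a.
  exact: le_trans (coordinate_le_mul_morphism lrho injrho Mrho _ _) (PM a).
(* Any e with M * e < 1 contradicts |tau F| = 1 for tau with tail bound e. *)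
pose e := (M + 1)^-1 / 2.
have e0 : 0 < e by rewrite divr_gt0// invr_gt0 ltr_wpDl.
have [n|N FN] :=
    @bounded_sum_small_tail R (fun n => nrm (F (h n))) (l1_norm F) e _ e0.
  exact: sum_nrm_le_l1_norm.
have [tau [tauE tau_le]] := tail_functional injh UU Utail M0 lin_lam lamM N.
have tau1 : phi tau = 1.
  have cst1 : (fun=> 1 : R[i]^o) @ U --> phi tau.
    apply: cvg_trans (phiE tau); apply: near_eq_cvg.
    apply: filterS (Utail N) => n Nn.
    by rewrite /x tauE// /lam rhoK /= eqxx.
  exact: (@norm_cvg_unique R[i] R[i]^o _ _ _ _ cst1 (cvg_cst _)).
have := tau_le F e FN.
have -> : tau F = 1 by rewrite -tau1 -phiF.
rewrite nrm1 mulrA ler_pdivlMr// mul1r; apply/negP; rewrite -ltNge.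
rewrite (@lt_trans _ _ 1)//; last by rewrite ltr1n.
by rewrite ltr_pdivrMr ?mul1r ?ltrDl// ltr_wpDl.
Qed.
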